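(* Let $R$ be a commutative unital ring that has determinant-induced factorization, and let $x, y \in R$ be non-zero-divisors such that $y$ is a non-zero-divisor on $R/(x)$. Consider the commutative square of localization maps $$\mathcal{L}(R,x,y):\qquad \begin{array}{ccc} R & \to & R_x \\ \downarrow & & \downarrow \\ R_y & \to & R_{xy}. \end{array}$$ 1. The square $\mathcal{L}(R,x,y)$ is a strong Milnor patching diagram. 2. If additionally $x$ is a non-zero-divisor on $R/(y)$ and $(x,y) \neq R$, then $\mathcal{L}(R,x,y)$ is a strong Milnor patching diagram which is not surjective.
   Context: All rings are commutative and unital. $R_x = R[1/x]$ denotes localization at the powers of $x$. An element $y$ is a non-zero-divisor on an $R$-module $M$ if multiplication by $y$ on $M$ is injective. A ring $R$ has determinant-induced factorization if for every $n \ge 1$, every $C \in \mathrm{Mat}_n(R)$ and every non-zero-divisor $b \in R$ dividing $\det(C)$, there are $A, B \in \mathrm{Mat}_n(R)$ with $\det(B) = b$ and $AB = C$. Let $\mathcal{F}$ be a commutative square of rings with maps $g_1: R \to R_1$, $g_2: R \to R_2$, $h_1: R_1 \to S$, $h_2: R_2 \to S$, $h_1 g_1 = h_2 g_2$. Let $\varphi: R \to R_1 \oplus R_2$, $r \mapsto (g_1(r), g_2(r))$ and $\psi: R_1 \oplus R_2 \to S$, $(r_1, r_2) \mapsto h_1(r_1) - h_2(r_2)$. The square is cartesian if $0 \to R \xrightarrow{\varphi} R_1 \oplus R_2 \xrightarrow{\psi} S$ is exact; it is surjective if $\psi$ is surjective. The square is a strong Milnor patching diagram if it is cartesian and for every $n\ge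 1$ and every $A_S \in \mathrm{GL}_n(S)$ there are $A_1 \in \mathrm{GL}_{2n}(R_1)$, $A_2 \in \mathrm{GL}_{2n}(R_2)$ such that $$\begin{pmatrix} A_S & 0 \\ 0 & A_S^{-1} \end{pmatrix} = h_1(A_1) h_2(A_2),$$ where ring homomorphisms are applied to matrices entrywise. For $\mathcal{L}(R,x,y)$ one takes $R_1 = R_x$, $R_2 = R_y$, $S = R_{xy}$. *)

(* Defs.v *)
From HB Require Import structures.
From mathcomp Require Import all_boot all_algebra generic_quotient ring_quotient.
From mathcomp Require Import ring.
From mathcomp Require Import boolp classical_sets.

Set Implicit Arguments.
Unset Strict Implicit.
Unset Printing Implicit Defensive.

Import GRing.Theory.
Local Open Scope ring_scope.
Local Open Scope quotient_scope.
Local Open Scope classical_set_scope.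

(* Rings are [comPzRingType]s: the zero ring is allowed. *)

(* [(a, n)] stands for [a / x ^+ n]. The factor [x ^+ k] is needed because [x]
   may be a zero-divisor. *)
Definition loc_equiv (R : comPzRingType) (x : R) (p q : R * nat) : bool :=
  `[< exists k, x ^+ k * (x ^+ q.2 * p.1) = x ^+ k * (x ^+ p.2 * q.1) >].

Section Localization.
Variables (R : comPzRingType) (x : R).
Implicit Types p q r : R * nat.

Lemma loc_equiv_class : equiv_class_of (loc_equiv x).
Proof.
split=> [p|p q|q p r].
- by apply/asboolP; exists 0%N.
- by apply/asboolP/asboolP => -[k /esym e]; exists k.
move=> /asboolP[k e1] /asboolP[l e2]; apply/asboolP.
exists (k + l + q.2)%N; rewrite !exprD.
transitivity (x ^+ l * x ^+ r.2 * (x ^+ k * (x ^+ q.2 * p.1))); first by ring.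
rewrite e1.
transitivity (x ^+ k * x ^+ p.2 * (x ^+ l * (x ^+ r.2 * q.1))); first by ring.
by rewrite e2; ring.
Qed.

Canonical loc_equivRel := EquivRelPack loc_equiv_class.
Canonical loc_encModRel := defaultEncModRel (loc_equiv x).

(* The localization R[1/x]. *)
Definition loc := {eq_quot loc_equiv x}.
HB.instance Definition _ : EqQuotient _ (loc_equiv x) loc := EqQuotient.on loc.
HB.instance Definition _ := Choice.on loc.

Lemma loc_eqP p q :
  reflect (exists k, x ^+ k * (x ^+ q.2 * p.1) = x ^+ k * (x ^+ p.2 * q.1))
          (p == q %[mod loc]).
Proof. by rewrite piE; apply: asboolP. Qed.

Lemma loc_reprP p :
  exists k, x ^+ k * (x ^+ (repr (\pi_loc p)).2 * p.1)
            = x ^+ k * (x ^+ p.2 * (repr (\pi_loc p)).1).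
Proof. by apply/loc_eqP; rewrite reprK. Qed.

Definition loc_zero : loc := lift_cst loc (0 : R, 0%N).
Definition loc_one : loc := lift_cst loc (1 : R, 0%N).

Definition loc_opp_pre p : R * nat := (- p.1, p.2).
Definition loc_add_pre p q : R * nat :=
  (x ^+ q.2 * p.1 + x ^+ p.2 * q.1, (p.2 + q.2)%N).
Definition loc_mul_pre p q : R * nat := (p.1 * q.1, (p.2 + q.2)%N).

Definition loc_opp := lift_op1 loc loc_opp_pre.
Definition loc_add := lift_op2 loc loc_add_pre.
Definition loc_mul := lift_op2 loc loc_mul_pre.

Canonical loc_pi_zero_morph := PiConst loc_zero.
Canonical loc_pi_one_morph := PiConst loc_one.

Lemma loc_pi_opp : {morph \pi_loc : p / loc_opp_pre p >-> loc_opp p}.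
Proof.
move=> p; unlock loc_opp; apply/eqP/loc_eqP.
by have [k e] := loc_reprP p; exists k => /=; rewrite !mulrN e.
Qed.
Canonical loc_pi_opp_morph := PiMorph1 loc_pi_opp.

Lemma loc_pi_add : {morph \pi_loc : p q / loc_add_pre p q >-> loc_add p q}.
Proof.
move=> p q; unlock loc_add; apply/eqP/loc_eqP.
have [k] := loc_reprP p; have [l] := loc_reprP q.
move: (repr (\pi_loc p)) (repr (\pi_loc q)) => [c m] [d n] /=.
case: p q => [a i] [b j] /= e2 e1.
exists (k + l)%N; rewrite !exprD.
transitivity (x ^+ l * x ^+ n * x ^+ j * (x ^+ k * (x ^+ m * a))
  + x ^+ k * x ^+ m * x ^+ i * (x ^+ l * (x ^+ n * b))); first by ring.
by rewrite e1 e2; ring.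
Qed.
Canonical loc_pi_add_morph := PiMorph2 loc_pi_add.

Lemma loc_pi_mul : {morph \pi_loc : p q / loc_mul_pre p q >-> loc_mul p q}.
Proof.
move=> p q; unlock loc_mul; apply/eqP/loc_eqP.
have [k] := loc_reprP p; have [l] := loc_reprP q.
move: (repr (\pi_loc p)) (repr (\pi_loc q)) => [c m] [d n] /=.
case: p q => [a i] [b j] /= e2 e1.
exists (k + l)%N; rewrite !exprD.
transitivity ((x ^+ k * (x ^+ m * a)) * (x ^+ l * (x ^+ n * b))); first by ring.
by rewrite e1 e2; ring.
Qed.
Canonical loc_pi_mul_morph := PiMorph2 loc_pi_mul.

Fact loc_addA : associative loc_add.
Proof.
move=> p q r; rewrite -[p]reprK -[q]reprK -[r]reprK !piE /=.
by apply/eqP/loc_eqP; exists 0%N; rewrite /= !exprD; ring.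
Qed.

Fact loc_addC : commutative loc_add.
Proof.
move=> p q; rewrite -[p]reprK -[q]reprK !piE /=.
by apply/eqP/loc_eqP; exists 0%N; rewrite /= !exprD; ring.
Qed.

Fact loc_add0 : left_id loc_zero loc_add.
Proof.
move=> p; rewrite -[p]reprK !piE /=.
by apply/eqP/loc_eqP; exists 0%N; rewrite /= !exprD; ring.
Qed.

Fact loc_addN : left_inverse loc_zero loc_opp loc_add.
Proof.
move=> p; rewrite -[p]reprK !piE /=.
by apply/eqP/loc_eqP; exists 0%N; rewrite /= !exprD; ring.
Qed.

HB.instance Definition _ :=
  GRing.isZmodule.Build loc loc_addA loc_addC loc_add0 loc_addN.

Fact loc_mulA : associative loc_mul.
Proof.
move=> p q r; rewrite -[p]reprK -[q]reprK -[r]reprK !piE /=.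
by apply/eqP/loc_eqP; exists 0%N; rewrite /= !exprD; ring.
Qed.

Fact loc_mulC : commutative loc_mul.
Proof.
move=> p q; rewrite -[p]reprK -[q]reprK !piE /=.
by apply/eqP/loc_eqP; exists 0%N; rewrite /= !exprD; ring.
Qed.

Fact loc_mul1 : left_id loc_one loc_mul.
Proof.
move=> p; rewrite -[p]reprK !piE /=.
by apply/eqP/loc_eqP; exists 0%N; rewrite /= !exprD; ring.
Qed.

Fact loc_mulD : left_distributive loc_mul loc_add.
Proof.
move=> p q r; rewrite -[p]reprK -[q]reprK -[r]reprK !piE /=.
by apply/eqP/loc_eqP; exists 0%N; rewrite /= !exprD; ring.
Qed.

HB.instance Definition _ :=
  GRing.Zmodule_isComPzRing.Build loc loc_mulA loc_mulC loc_mul1 loc_mulD.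


Lemma loc_addE p q : \pi_loc p + \pi_loc q = \pi_loc (loc_add_pre p q).
Proof. by rewrite loc_pi_add. Qed.

Lemma loc_oppE p : - \pi_loc p = \pi_loc (loc_opp_pre p).
Proof. by rewrite loc_pi_opp. Qed.

Lemma loc_mulE p q : \pi_loc p * \pi_loc q = \pi_loc (loc_mul_pre p q).
Proof. by rewrite loc_pi_mul. Qed.

Lemma loc_oneE : 1 = \pi_loc (1, 0%N).
Proof. by rewrite /GRing.one /= piE. Qed.

Definition loc_map (a : R) : loc := \pi_loc (a, 0%N).

Fact loc_map_zmod_morphism : zmod_morphism loc_map.
Proof.
move=> a b; rewrite /loc_map loc_oppE loc_addE.
by apply/eqP/loc_eqP; exists 0%N => /=; ring.
Qed.

Fact loc_map_monoid_morphism : monoid_morphism loc_map.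
Proof. by split=> [|a b]; rewrite /loc_map ?loc_oneE ?loc_mulE. Qed.

HB.instance Definition _ :=
  GRing.isZmodMorphism.Build R loc loc_map loc_map_zmod_morphism.
HB.instance Definition _ :=
  GRing.isMonoidMorphism.Build R loc loc_map loc_map_monoid_morphism.

(* The ring morphism [a / x ^+ n |-> f a * u ^+ n] out of R[1/x] induced by a
   morphism [f] sending [x] to an invertible element with inverse [u]. *)
Section Lift.
Variables (A : comPzRingType) (f : {rmorphism R -> A}) (u : A).
Hypothesis fxu : f x * u = 1.

Definition loc_lift of f x * u = 1 := fun p : loc => f (repr p).1 * u ^+ (repr p).2.
Local Notation lift := (loc_lift fxu).

Lemma loc_lift_pi p : lift (\pi_loc p) = f p.1 * u ^+ p.2.
Proof.
rewrite /loc_lift; have [k e] := loc_reprP p.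
move: (repr (\pi_loc p)) e => q /(congr1 f); rewrite !rmorphM !rmorphXn => e.
have ux n : f x ^+ n * u ^+ n = 1 by rewrite -exprMn fxu expr1n.
transitivity (f q.1 * u ^+ q.2 * (f x ^+ k * u ^+ k) * (f x ^+ p.2 * u ^+ p.2)).
  by rewrite !ux !mulr1.
transitivity (u ^+ k * u ^+ p.2 * u ^+ q.2 * (f x ^+ k * (f x ^+ p.2 * f q.1))).
  by ring.
rewrite -e; transitivity
  (f p.1 * u ^+ p.2 * (f x ^+ k * u ^+ k) * (f x ^+ q.2 * u ^+ q.2));
  first by ring.
by rewrite !ux !mulr1.
Qed.

Fact loc_lift_zmod_morphism : zmod_morphism lift.
Proof.
move=> p q; rewrite -[p]reprK -[q]reprK loc_oppE loc_addE !loc_lift_pi /=.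
move: (repr p) (repr q) => [a m] [b n] /=.
have ux k : f x ^+ k * u ^+ k = 1 by rewrite -exprMn fxu expr1n.
rewrite rmorphD !rmorphM !rmorphN !rmorphXn exprD.
transitivity (f a * u ^+ m * (f x ^+ n * u ^+ n)
  - f b * u ^+ n * (f x ^+ m * u ^+ m)); first by ring.
by rewrite !ux !mulr1.
Qed.

Fact loc_lift_monoid_morphism : monoid_morphism lift.
Proof.
split=> [|p q]; first by rewrite loc_oneE loc_lift_pi rmorph1 mulr1.
rewrite -[p]reprK -[q]reprK loc_mulE !loc_lift_pi /=.
by rewrite rmorphM exprD; ring.
Qed.

HB.instance Definition _ :=
  GRing.isZmodMorphism.Build loc A lift loc_lift_zmod_morphism.
HB.instance Definition _ :=
  GRing.isMonoidMorphism.Build loc A lift loc_lift_monoid_morphism.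

Lemma loc_lift_map a : lift (loc_map a) = f a.
Proof. by rewrite loc_lift_pi mulr1. Qed.
End Lift.
End Localization.

Section LocProduct.
Variables (R : comPzRingType) (x y : R).

(* In R[1/(xy)], the inverse of [x] is [y / (x * y)] and that of [y] is
   [x / (x * y)]. *)
Fact loc_map_mulVl :
  loc_map (x * y) x * \pi_(loc (x * y)) (y, 1%N) = 1.
Proof.
rewrite loc_mulE loc_oneE; apply/eqP/loc_eqP.
by exists 0%N => /=; ring.
Qed.

Fact loc_map_mulVr :
  loc_map (x * y) y * \pi_(loc (x * y)) (x, 1%N) = 1.
Proof.
rewrite loc_mulE loc_oneE; apply/eqP/loc_eqP.
by exists 0%N => /=; ring.
Qed.

Definition loc_mapl : {rmorphism loc x -> loc (x * y)} := loc_lift loc_map_mulVl.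
Definition loc_mapr : {rmorphism loc y -> loc (x * y)} := loc_lift loc_map_mulVr.
End LocProduct.

Record comm_square := CommSquare {
  sq_R : comPzRingType;
  sq_R1 : comPzRingType;
  sq_R2 : comPzRingType;
  sq_S : comPzRingType;
  sq_g1 : {rmorphism sq_R -> sq_R1};
  sq_g2 : {rmorphism sq_R -> sq_R2};
  sq_h1 : {rmorphism sq_R1 -> sq_S};
  sq_h2 : {rmorphism sq_R2 -> sq_S};
  sq_comm : forall r, sq_h1 (sq_g1 r) = sq_h2 (sq_g2 r)
}.

Fact loc_square_comm (R : comPzRingType) (x y r : R) :
  loc_mapl x y (loc_map x r) = loc_mapr x y (loc_map y r).
Proof. by rewrite /loc_mapl /loc_mapr /= !loc_lift_map. Qed.

Definition loc_square (R : comPzRingType) (x y : R) : comm_square :=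
  @CommSquare R (loc x) (loc y) (loc (x * y)) (loc_map x) (loc_map y)
    (loc_mapl x y) (loc_mapr x y) (loc_square_comm x y).

Section Square.
Variable F : comm_square.

Definition sq_phi (r : sq_R F) : sq_R1 F * sq_R2 F := (sq_g1 F r, sq_g2 F r).
Definition sq_psi (p : sq_R1 F * sq_R2 F) : sq_S F :=
  sq_h1 F p.1 - sq_h2 F p.2.

Definition cartesian : Prop :=
  injective sq_phi /\ range sq_phi = [set p | sq_psi p = 0].

Definition surjective_square : Prop := range sq_psi = setT.
End Square.

Definition mx_inverse (R : comPzRingType) (n : nat) (A B : 'M[R]_n) : Prop :=
  A *m B = 1%:M /\ B *m A = 1%:M.

Definition GLmx (R : comPzRingType) (n : nat) : set 'M[R]_n :=
  [set A | exists B, mx_inverse A B].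

Definition strong_Milnor (F : comm_square) : Prop :=
  cartesian F /\
  forall n : nat, (0 < n)%N -> forall A A' : 'M[sq_S F]_n, mx_inverse A A' ->
  exists (A1 : 'M[sq_R1 F]_(n + n)) (A2 : 'M[sq_R2 F]_(n + n)),
    [/\ GLmx A1, GLmx A2 &
        block_mx A 0 0 A' = map_mx (sq_h1 F) A1 *m map_mx (sq_h2 F) A2].

Definition nonzerodivisor (R : comPzRingType) (M : lmodType R) (y : R) : Prop :=
  injective (fun m : M => y *: m).

(* The [R]-module R/(x). The library's [{ideal_quot _}] does not apply, since
   it requires a proper ideal and [x] may be a unit. *)
Section QuotientModule.
Variables (R : comPzRingType) (x : R).

Definition principal : {pred R} := fun a => `[< exists c, a = x * c >].

Fact principal_zmod_closed : zmod_closed principal.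
Proof.
split=> [|a b /asboolP[c ->] /asboolP[d ->]]; apply/asboolP.
  by exists 0; rewrite mulr0.
by exists (c - d); rewrite mulrBr.
Qed.

HB.instance Definition _ :=
  GRing.isZmodClosed.Build R principal principal_zmod_closed.

Definition principal_quot := Quotient.quot principal.
Local Notation Q := principal_quot.
HB.instance Definition _ := GRing.Zmodule.on Q.
HB.instance Definition _ : EqQuotient R (Quotient.equiv principal) Q :=
  EqQuotient.on Q.

Definition principal_quot_scale (a : R) (v : Q) : Q := \pi_Q (a * repr v).

Fact principal_quot_scale_pi a b :
  principal_quot_scale a (\pi_Q b) = \pi_Q (a * b).
Proof.
apply/eqP; rewrite -Quotient.idealrBE -mulrBr.
have : repr (\pi_Q b) - b \in principal by rewrite Quotient.idealrBE reprK.
rewrite /in_mem /= => /asboolP[c ->].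
by apply/asboolP; exists (a * c); rewrite mulrCA.
Qed.

Fact pq_addE a b : \pi_Q a + \pi_Q b = \pi_Q (a + b).
Proof. by rewrite [RHS]Quotient.pi_add. Qed.

Fact pq_scalerA a b v :
  principal_quot_scale a (principal_quot_scale b v)
  = principal_quot_scale (a * b) v.
Proof. by rewrite -[v]reprK !principal_quot_scale_pi mulrA reprK. Qed.

Fact pq_scale1r : left_id 1 principal_quot_scale.
Proof. by move=> v; rewrite -[v]reprK principal_quot_scale_pi mul1r. Qed.

Fact pq_scalerDr : right_distributive principal_quot_scale +%R.
Proof.
move=> a v w; rewrite -[v]reprK -[w]reprK pq_addE !principal_quot_scale_pi.
by rewrite pq_addE mulrDr.
Qed.

Fact pq_scalerDl v : {morph principal_quot_scale^~ v : a b / a + b}.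
Proof.
move=> a b; rewrite -[v]reprK !principal_quot_scale_pi.
by rewrite pq_addE mulrDl.
Qed.

HB.instance Definition _ := GRing.Zmodule_isLmodule.Build R Q
  pq_scalerA pq_scale1r pq_scalerDr pq_scalerDl.
End QuotientModule.

Definition ideal2 (R : comPzRingType) (x y : R) : set R :=
  [set r | exists a b, r = a * x + b * y].

Definition det_induced_factorization (R : comPzRingType) : Prop :=
  forall n : nat, (0 < n)%N -> forall (C : 'M[R]_n) (b : R),
  nonzerodivisor R^o b -> (exists c, \det C = b * c) ->
  exists A B : 'M[R]_n, \det B = b /\ A *m B = C.

(* Main.v *)
(* Clear denominators: (x y)^N diag(A, A^-1) comes from a matrix C over R, and
   det C = (x y)^(2 n N). This product splits as b = y^(2 n N) times a power of
   x (for (x y)^N A alone, the determinant need not split), so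
   determinant-induced factorization gives C = P Q with det Q = b and
   det P = x^(2 n N). Thus P is invertible over R_x and Q over R_y; dividing
   them by x^N and y^N respectively gives A_1 and A_2. *)
Require Import Defs.
From mathcomp Require Import all_boot all_algebra.
From mathcomp Require Import classical_sets.
From mathcomp Require Import ring generic_quotient ring_quotient boolp.

Set Implicit Arguments.
Unset Strict Implicit.
Unset Printing Implicit Defensive.

Import GRing.Theory.

Local Open Scope quotient_scope.
Local Open Scope ring_scope.

Section LocalizationTheory.
Variables (R : comPzRingType) (x : R).

Lemma loc_mapV : loc_map x x * \pi_(loc x) (1, 1%N) = 1.
Proof.
by rewrite loc_mulE loc_oneE; apply/eqP/loc_eqP; exists 0%N => /=; ring.
Qed.

Lemma loc_num_den (a : loc x) :
  loc_map x (x ^+ (repr a).2) * a = loc_map x (repr a).1.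
Proof.
rewrite -{2}[a]reprK loc_mulE; apply/eqP/loc_eqP.
by exists 0%N => /=; ring.
Qed.

(** The common denominator is the product of all the chosen ones; each numerator absorbs the
    denominators of the other entries. *)
Lemma loc_common_den (I : finType) (f : I -> loc x) :
  exists (N : nat) (c : I -> R),
    forall i, loc_map x (x ^+ N) * f i = loc_map x (c i).
Proof.
pose d i := (repr (f i)).2; exists (\sum_i d i)%N.
exists (fun i => x ^+ (\sum_(j | j != i) d j) * (repr (f i)).1) => i.
by rewrite (bigD1 i) //= addnC exprD !rmorphM -mulrA loc_num_den.
Qed.

Lemma loc_common_den_mx m n (A : 'M[loc x]_(m, n)) :
  exists (N : nat) (C : 'M[R]_(m, n)),
    map_mx (loc_map x) C = loc_map x (x ^+ N) *: A.
Proof.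
have [N [c cE]] := loc_common_den (fun p : 'I_m * 'I_n => A p.1 p.2).
exists N, (\matrix_(i, j) c (i, j)).
by apply/matrixP => i j; rewrite !mxE -cE.
Qed.

Lemma loc_map_inj : GRing.lreg x -> injective (loc_map x).
Proof.
move=> xreg a b /eqP/loc_eqP[k] /= /(lregX xreg).
by rewrite !expr0 !mul1r.
Qed.

End LocalizationTheory.

Lemma GLmx_det (R : comPzRingType) n (A : 'M[R]_n) (u : R) :
  \det A * u = 1 -> GLmx A.
Proof.
move=> detu; exists (u *: \adj A); split.
  by rewrite -scalemxAr mul_mx_adj scale_scalar_mx mulrC detu.
by rewrite -scalemxAl mul_adj_mx scale_scalar_mx mulrC detu.
Qed.

Lemma GLmx_scale (R : comPzRingType) n (A : 'M[R]_n) (u v : R) :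
  u * v = 1 -> GLmx A -> GLmx (u *: A).
Proof.
move=> uv [B [AB BA]]; exists (v *: B).
by split; rewrite -scalemxAl -scalemxAr scalerA ?AB ?BA ?(mulrC v) uv scale1r.
Qed.

(** This makes both patching factors invertible: the determinant and the scalar are units, since [x]
    is inverted. *)
Lemma GLmx_loc_det (R : comPzRingType) (x : R) n (A : 'M[R]_n) M N :
  \det A = x ^+ M ->
  GLmx ((\pi_(loc x) (1, 1%N)) ^+ N *: map_mx (loc_map x) A).
Proof.
move=> detA; apply: (@GLmx_scale _ _ _ _ (loc_map x x ^+ N)).
  by rewrite -exprMn mulrC loc_mapV expr1n.
apply: (@GLmx_det _ _ _ ((\pi_(loc x) (1, 1%N)) ^+ M)).
by rewrite det_map_mx detA rmorphXn -exprMn loc_mapV expr1n.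
Qed.

Lemma principal_quot_eq0 (R : comPzRingType) (x a : R) :
  \pi_(principal_quot x) a = 0 <-> exists c, a = x * c.
Proof.
have -> : 0 = \pi_(principal_quot x) 0.
  by apply: (addrI (\pi_(principal_quot x) 0)); rewrite addr0 pq_addE addr0.
split=> [/eqP|[c e]].
  rewrite -Quotient.idealrBE subr0 /in_mem /=.
  by move=> /asboolP.
apply/eqP; rewrite -Quotient.idealrBE subr0 /in_mem /=.
by apply/asboolP; exists c.
Qed.

Lemma nonzerodivisor_principal_quot (R : comPzRingType) (x y : R) :
  nonzerodivisor (principal_quot x) y ->
  forall a b, y * a = x * b -> exists c, a = x * c.
Proof.
move=> yreg a b yaxb; apply/principal_quot_eq0; apply: yreg.
rewrite scaler0 [LHS]principal_quot_scale_pi.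
by apply/principal_quot_eq0; exists b.
Qed.

Section RegularSequence.
Variables (R : comPzRingType) (x y : R).
Hypothesis xreg : GRing.lreg x.
Hypothesis xyreg : forall a b, y * a = x * b -> exists c, a = x * c.

(** Iterating the hypothesis shows that [y ^+ m] is regular modulo [x]. Induction on [n] then
    extracts one factor [x] from [a] at a time and cancels it, as [x] is regular. *)
Lemma regular_seq_exp m n a b :
  y ^+ m * a = x ^+ n * b -> exists c, a = x ^+ n * c.
Proof.
have ym k a' b' : y ^+ k * a' = x * b' -> exists c, a' = x * c.
  elim: k a' b' => [|k IH] a' b'; first by rewrite mul1r; exists b'.
  by rewrite exprSr -mulrA => /IH[c /xyreg].
elim: n a b => [|n IH] a b e; first by exists a; rewrite mul1r.
have [|a' a'E] := ym m a (x ^+ n * b); first by rewrite e exprS mulrA.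
have [|c cE] := IH a' b; last by exists c; rewrite a'E cE exprS mulrA.
by apply: xreg; rewrite [RHS]mulrA -exprS -e a'E mulrCA.
Qed.

Hypothesis yreg : GRing.lreg y.

Lemma loc_mapl_pi a n :
  loc_mapl x y (\pi_(loc x) (a, n)) = \pi_(loc (x * y)) (a * y ^+ n, n).
Proof.
rewrite /loc_mapl /= loc_lift_pi /=.
have -> : \pi_(loc (x * y)) (y, 1%N) ^+ n = \pi_(loc (x * y)) (y ^+ n, n).
  elim: n => [|n IH]; first by rewrite !expr0 -loc_oneE.
  by rewrite !exprS IH loc_mulE.
by rewrite loc_mulE /loc_mul_pre.
Qed.

Lemma loc_mapr_pi b n :
  loc_mapr x y (\pi_(loc y) (b, n)) = \pi_(loc (x * y)) (b * x ^+ n, n).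
Proof.
rewrite /loc_mapr /= loc_lift_pi /=.
have -> : \pi_(loc (x * y)) (x, 1%N) ^+ n = \pi_(loc (x * y)) (x ^+ n, n).
  elim: n => [|n IH]; first by rewrite !expr0 -loc_oneE.
  by rewrite !exprS IH loc_mulE.
by rewrite loc_mulE /loc_mul_pre.
Qed.

(** If [a / x ^+ n] and [b / y ^+ m] agree in R[1/(xy)], then [y ^+ m * a = x ^+ n * b]. Regularity
    gives [a = x ^+ n * r], hence [b = y ^+ m * r], and both fractions come from [r]. *)
Lemma loc_square_cartesian : cartesian (loc_square x y).
Proof.
split=> [a b [/(loc_map_inj xreg)]//|].
apply/seteqP; split=> [_ [r _ <-]|[p q]]; rewrite /sq_psi /=.
  by rewrite loc_square_comm subrr.
rewrite -[p]reprK -[q]reprK.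
move: (repr p) (repr q) => [a n] [b m].
move=> /subr0_eq; rewrite loc_mapl_pi loc_mapr_pi.
move=> /eqP/loc_eqP[k] /= /(lregX (lregM xreg yreg)) e.
(* Over powers of [x * y] the numerators are [a * y ^+ n] and [b * x ^+ m], so a regular factor
   [y ^+ n * x ^+ m] cancels. *)
have {}e : y ^+ m * a = x ^+ n * b.
  apply: (lregM (lregX (n := n) yreg) (lregX (n := m) xreg)).
  by rewrite !exprMn in e; ring: e.
have [r aE] := regular_seq_exp e; exists r => //.
have bE : b = y ^+ m * r.
  by apply: (lregX (n := n) xreg); rewrite -e aE mulrCA.
rewrite /sq_phi /= aE bE; congr pair; apply/eqP/loc_eqP; exists 0%N => /=; ring.
Qed.

(* Equality of [1 / (x * y)] and [a / x ^+ n - b / y ^+ m] forces [1] into the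
   ideal [(x, y)]. *)
Lemma loc_square_not_surjective :
  ideal2 x y <> setT -> ~ surjective_square (loc_square x y).
Proof.
move=> xyneq sur; apply: xyneq.
have : range (@sq_psi (loc_square x y)) (\pi_(loc (x * y)) (1, 1%N)).
  by rewrite sur.
move=> [[p q] _]; rewrite /sq_psi /=.
rewrite -[p]reprK -[q]reprK.
move: (repr p) (repr q) => [a n] [b m].
rewrite loc_mapl_pi loc_mapr_pi loc_oppE loc_addE.
move=> /eqP/loc_eqP[k] /= /(lregX (lregM xreg yreg)) e.
(* This is the equality of fractions multiplied by [x ^+ n.+1 * y ^+ m.+1], with the terms divisible
   by [y ^+ m] collected on the left. *)
have {}e : y ^+ m * (x ^+ n - y * (x * a)) = x ^+ n.+1 * (- (y * b)).
  apply: (lregM (lregX (n := n) yreg) (lregX (n := m) xreg)).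
  apply/subr0_eq; move/esym/eqP: e; rewrite -subr_eq0 => /eqP <-.
  by rewrite exprS !exprD !exprMn; ring.
have [c cE] := regular_seq_exp e.
(* Now [y * (x * a) = x ^+ n * (1 - x * c)], so [x * a] is also a multiple of [x ^+ n], and
   cancelling [x ^+ n] leaves [1 = c * x + d * y]. *)
have [|d dE] := @regular_seq_exp 1 n (x * a) (1 - x * c).
  by rewrite expr1 mulrBr mulr1 [x ^+ n * _]mulrA -exprSr -cE; ring.
have one : 1 = c * x + d * y.
  apply: (lregX (n := n) xreg); rewrite mulr1 mulrDr.
  transitivity (x ^+ n.+1 * c + y * (x * a)); first by rewrite -cE subrK.
  by rewrite dE exprS; ring.
apply/seteqP; split=> // r _.
by exists (r * c), (r * d); rewrite -[LHS]mulr1 one mulrDr !mulrA.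
Qed.

Lemma loc_square_strong_Milnor :
  det_induced_factorization R -> strong_Milnor (loc_square x y).
Proof.
move=> dif; split=> [|n n_gt0 A A' [AA' _]]; first exact: loc_square_cartesian.
pose z := x * y; have zreg : GRing.lreg z by apply: lregM.
have [N [C CE]] := loc_common_den_mx (block_mx A 0 0 A' : 'M[loc z]__).
(* The block matrix has determinant 1, so the identity holds in R[1/(xy)]; it descends to [R]
   because [z] is regular. *)
have detC : \det C = x ^+ (N * (n + n)) * y ^+ (N * (n + n)).
  apply: (loc_map_inj zreg); rewrite -det_map_mx CE detZ det_ublock -det_mulmx.
  by rewrite AA' det1 mulr1 -rmorphXn -exprM exprMn.
have [|||P [Q [detQ PQ]]] := dif (n + n)%N _ C (y ^+ (N * (n + n))).
- by rewrite addn_gt0 n_gt0.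
- exact: lregX.
- by exists (x ^+ (N * (n + n))); rewrite mulrC.
(* The determinant of [Q] is a power of [y], hence regular, and cancels from
   [\det P * \det Q = \det C]. *)
have detP : \det P = x ^+ (N * (n + n)).
  apply: (lregX (n := N * (n + n)) yreg).
  by rewrite -{1}detQ mulrC -det_mulmx PQ detC mulrC.
exists ((\pi_(loc x) (1, 1%N)) ^+ N *: map_mx (loc_map x) P).
exists ((\pi_(loc y) (1, 1%N)) ^+ N *: map_mx (loc_map y) Q).
split; [exact: GLmx_loc_det detP|exact: GLmx_loc_det detQ|].
rewrite /= !map_mxZ -scalemxAl -scalemxAr scalerA.
have -> : map_mx (loc_mapl x y) (map_mx (loc_map x) P) = map_mx (loc_map z) P.
  by apply/matrixP => i j; rewrite !mxE /loc_mapl /= loc_lift_map.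
have -> : map_mx (loc_mapr x y) (map_mx (loc_map y) Q) = map_mx (loc_map z) Q.
  by apply/matrixP => i j; rewrite !mxE /loc_mapr /= loc_lift_map.
rewrite -map_mxM PQ CE scalerA !rmorphXn -!exprMn loc_mapl_pi loc_mapr_pi.
(* The remaining scalar is the [N]-th power of the product of [1 / x], [1 / y] and [z = x * y]. *)
rewrite [X in X ^+ N](_ : _ = 1) ?expr1n ?scale1r //.
rewrite !loc_mulE loc_oneE; apply/eqP/loc_eqP; exists 0%N => /=.
by rewrite /z; ring.
Qed.

End RegularSequence.

Theorem theorem1p6 (R : comPzRingType) (x y : R) :
  det_induced_factorization R ->
  nonzerodivisor R^o x ->
  nonzerodivisor R^o y ->
  nonzerodivisor (principal_quot x) y ->
  strong_Milnor (loc_square x y) /\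
  (nonzerodivisor (principal_quot y) x ->
   ideal2 x y <> setT ->
   strong_Milnor (loc_square x y) /\ ~ surjective_square (loc_square x y)).
Proof.
move=> dif xreg yreg /nonzerodivisor_principal_quot xyreg.
have sM := @loc_square_strong_Milnor R x y xreg xyreg yreg dif.
split=> [|_ xyneq]; [exact: sM|split; [exact: sM|]].
exact: (@loc_square_not_surjective R x y xreg xyreg yreg).
Qed.
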